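(* Let $n,k$ be integers with $k\leqslant n<2k-3$. Then there exists $M$ such that for every integer $m\geqslant M$ we have $\alpha(m,n,k)=h(m,n,k)$, and every $(m,n,k)$-intersecting family of maximum cardinality equals $\mathcal{H}_t^{m,n,k}$ for some $t\in[n]$.
   Context: For positive integers $a\leqslant b$, $[a,b]=\{a,a+1,\dots,b\}$ and $[a]=[1,a]$; $\binom{X}{k}$ denotes the family of all $k$-subsets of a set $X$. A family of sets is intersecting if no two of its members are disjoint. For integers $0<k\leqslant n<2k<m$, an $(m,n,k)$-intersecting family is an intersecting family $\mathcal{F}$ with $\binom{[n]}{k}\subseteq\mathcal{F}\subseteq\binom{[m]}{k}$, and $\alpha(m,n,k)$ is the maximum cardinality of an $(m,n,k)$-intersecting family. Define $h(m,n,k)=\binom{n}{k}+\sum_{i=1}^{2k-n-1}\binom{n-1}{k-i-1}\binom{m-n}{i}$. For $t\in[n]$, define \[ \mathcal{H}_t^{m,n,k}=\binom{[n]}{k}\cup\bigcup_{i=1}^{2k-n-1}\left\{A\cup B\cup\{t\}\ \middle|\ A\in\binom{[n]\setminus\{t\}}{k-i-1},\ B\in\binom{[n+1,m]}{i}\right\}, \] an $(m,n,k)$-intersecting family of cardinality $h(m,n,k)$. *)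

(* Defs.v *)
From mathcomp Require Import all_boot.
Unset Printing Implicit Defensive.

(* Ground set [m] = {1,...,m} is modelled by 'I_m, element j+1 <-> ordinal j.
   Hence [n] = {i : 'I_m | i < n} and [n+1,m] = {i : 'I_m | n <= i}. *)

Definition lowset (m n : nat) : {set 'I_m} := [set i : 'I_m | i < n].
Definition highset (m n : nat) : {set 'I_m} := [set i : 'I_m | n <= i].

Definition base (m n k : nat) : {set {set 'I_m}} :=
  [set A : {set 'I_m} | (A \subset lowset m n) && (#|A| == k)].

Definition intersecting {T : finType} (F : {set {set T}}) : Prop :=
  forall A B, A \in F -> B \in F -> A :&: B != set0.

Definition mnk_family (m n k : nat) (F : {set {set 'I_m}}) : Prop :=
  intersecting F /\ base m n k \subset F /\ (forall A, A \in F -> #|A| = k).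

Definition mnk_familyb (m n k : nat) (F : {set {set 'I_m}}) : bool :=
  [forall A in F, [forall B in F, A :&: B != set0]] &&
  ((base m n k) \subset F) && [forall A in F, #|A| == k].

Definition alpha (m n k : nat) : nat :=
  \max_(F : {set {set 'I_m}} | mnk_familyb m n k F) #|F|.

Definition h (m n k : nat) : nat :=
  'C(n, k) + \sum_(1 <= i < (2 * k - n - 1).+1) 'C(n - 1, k - i - 1) * 'C(m - n, i).

Definition Hfam (m n k : nat) (t : 'I_m) : {set {set 'I_m}} :=
  base m n k :|:
  \bigcup_(1 <= i < (2 * k - n - 1).+1)
    [set A :|: B :|: [set t] | A in [set A : {set 'I_m} |
                                   (A \subset lowset m n :\ t) && (#|A| == k - i - 1)],
                               B in [set B : {set 'I_m} |
                                   (B \subset highset m n) && (#|B| == i)]].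

(* Main.v *)
Require Import Defs.
From mathcomp Require Import all_boot zify.

(** Put [r = n - k + 1] and [s = 2k - n - 1], so that [r + s = k] and [n >= 2r + 2].
    A member of the family meets [[n]] in at least [r] points, since otherwise some
    [k]-subset of [[n]] avoids it.  Call an [r]-subset [A] of [[n]] popular if more than
    [s * 'C(m-n, s-1)] members have trace [A] on [[n]].  A popular [A] meets every
    member [Y], because one of the members with trace [A] avoids [Y] outside [[n]]; in
    particular popular sets intersect pairwise.  All unpopular traces together account
    for [O(m^(s-1))] members, so a family of size [h(m,n,k)] has at least, hence by
    Erdos-Ko-Rado exactly, ['C(n-1, r-1)] popular sets, and as [n > 2r] these are all the
    [r]-sets through some [t].  A member missing [t] and not contained in [[n]] is
    disjoint from one of them, so the family is contained in the extremal one.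

    Erdos-Ko-Rado with uniqueness is proved by Katona's cycle method.  In the
    equality case every cyclic order has exactly [r] arcs in the family; an arc in
    the family whose predecessor is not then forces the [r - 1] following arcs. *)

(** * The Erdos-Ko-Rado theorem *)

Lemma periodic_sum (X : pred nat) (n a : nat) :
  (forall j, X (j + n) = X j) -> \sum_(j < n) X (a + j) = \sum_(j < n) X j.
Proof.
move=> perX; elim: a => [|a IHa]; first by apply: eq_bigr.
case: n perX IHa => [|n] perX IHa; first by rewrite !big_ord0.
rewrite -IHa big_ord_recr big_ord_recl /= addnC addn0 addSnnS perX.
by congr (_ + _); apply: eq_bigr => j _; rewrite addSnnS.
Qed.

(** * Positions of pairwise intersecting arcs in a cyclic order *)

Section CyclicIntervals.

(** [X j] stands for: the arc of length [r] starting at [j] lies in the family. Arcs whose starts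
    are [e] apart with [r <= e <= n - r] are disjoint, whence [sparseX]. *)
Variables (n r : nat) (X : pred nat).
Hypotheses (r_gt0 : 0 < r) (le2rn : 2 * r <= n).
Hypothesis sparseX : forall j e, r <= e <= n - r -> X j -> ~~ X (j + e).

(** [X 0] excludes the positions from [r] to [n - r]; the other nonzero ones are paired as [d] and
    [d + (n - r)], of which at most one can lie in [X]. *)
Lemma cyclic_sum_pairs :
  X 0 -> \sum_(j < n) X j = 1 + \sum_(1 <= d < r) (X d + X (d + (n - r))).
Proof.
move=> X0; rewrite -(big_mkord xpredT (fun j => nat_of_bool (X j))).
rewrite (@big_cat_nat _ _ _ r) /=; [|lia|lia].
rewrite (@big_cat_nat _ _ _ (1 + (n - r)) r) /=; [|lia|lia].
rewrite [X in _ + (X + _)]big_nat_cond [X in _ + (X + _)]big1 => [|j /andP[rj _]].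
  rewrite big_ltn // X0 big_split /= add0n -addnA; congr (1 + (_ + _)).
  by rewrite big_addn; have ->: n - (n - r) = r by lia.
by apply/eqP; rewrite eqb0 -[j]add0n sparseX //; lia.
Qed.

Lemma cyclic_pair_le d : X d + X (d + (n - r)) <= 1.
Proof.
case Xd: (X d); last by case: (X _).
by rewrite (negPf (@sparseX d (n - r) _ Xd)) //; lia.
Qed.

Lemma cyclic_sum_le : X 0 -> \sum_(j < n) X j <= r.
Proof.
move=> X0; rewrite cyclic_sum_pairs //.
apply: (@leq_trans (1 + \sum_(1 <= d < r) 1)).
  by rewrite leq_add2l leq_sum // => d _; apply: cyclic_pair_le.
by rewrite sum_nat_const_nat; lia.
Qed.

Lemma cyclic_pair_eq d :
  X 0 -> \sum_(j < n) X j = r -> 0 < d < r -> X d + X (d + (n - r)) = 1.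
Proof.
move=> X0; rewrite cyclic_sum_pairs // => sumX dr.
have dI: d \in index_iota 1 r by rewrite mem_index_iota.
have : \sum_(1 <= d < r) 1 = r - 1 by rewrite sum_nat_const_nat muln1.
move: sumX; rewrite !(bigD1_seq d dI (iota_uniq _ _)) /=.
have := cyclic_pair_le d.
have : \sum_(i <- index_iota 1 r | i != d) (X i + X (i + (n - r)))
       <= \sum_(i <- index_iota 1 r | i != d) 1.
  by apply: leq_sum => i _; apply: cyclic_pair_le.
by lia.
Qed.

(** Each pair contributes exactly 1. The partner [n - 1] of [r - 1] is missing, so [r - 1] is
    present. If [d + 1] is present, then [d + 1 + (n - r - 1)], which is the partner of [d], is
    missing, so [d] is present; the gap [n - r - 1] is at least [r] because [2 * r < n]. *)
Lemma cyclic_interval_full d :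
  2 * r < n -> X 0 -> ~~ X n.-1 -> \sum_(j < n) X j = r -> d < r -> X d.
Proof.
move=> lt2rn X0 Xn sumX dr; have [e ->]: exists e, d = r - 1 - e.
  by exists (r - 1 - d); lia.
elim: e => [|e IHe]; set d0 := r - 1 - _.
  have [->//|d_gt0] := posnP d0.
  have : X d0 + X (d0 + (n - r)) = 1 by apply: cyclic_pair_eq => //; lia.
  have ->: d0 + (n - r) = n.-1 by lia.
  by rewrite (negPf Xn); case: (X d0).
have [->//|d_gt0] := posnP d0.
have : X d0 + X (d0 + (n - r)) = 1 by apply: cyclic_pair_eq => //; lia.
have : ~~ X (r - 1 - e + (n - r - 1)) by apply: sparseX => //; lia.
have ->: r - 1 - e + (n - r - 1) = d0 + (n - r) by lia.
by move=> /negPf->; case: (X d0).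
Qed.

End CyclicIntervals.

(* The cyclic order [s] is read periodically: [j] may exceed [size s]. *)
Definition arc {T : finType} (r : nat) (s : seq T) (j : nat) : {set T} :=
  [set x in take r (iter j (rot 1) s)].

Section Arcs.

Context {T : finType}.
Implicit Types (s : seq T) (D A : {set T}).

Lemma iter_rot1 j s : j <= size s -> iter j (rot 1) s = rot j s.
Proof.
elim: j => [|j IHj] js; first by rewrite rot0.
by rewrite iterS IHj 1?ltnW // -rotD ?add1n.
Qed.

Lemma perm_iter_rot1 j s : perm_eq (iter j (rot 1) s) s.
Proof. by elim: j => //= j IHj; apply: perm_trans (IHj); rewrite perm_rot. Qed.

Lemma arcD r s i j : arc r s (j + i) = arc r (iter i (rot 1) s) j.
Proof. by rewrite /arc iterD. Qed.

Lemma arc_periodic r s j : arc r s (j + size s) = arc r s j.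
Proof. by rewrite arcD iter_rot1 // rot_size. Qed.

(** After rotation to start at [j], the first arc lies among the first [e] entries, and the second
    among the remaining ones, without wrapping around. *)
Lemma arc_disjoint r s j e :
  uniq s -> r <= e <= size s - r -> arc r s j :&: arc r s (j + e) = set0.
Proof.
move=> us re; rewrite [j + e]addnC arcD -(add0n j) arcD add0n.
set t := iter j (rot 1) s.
have pts: perm_eq t s := perm_iter_rot1 j s.
have ut: uniq t by rewrite (perm_uniq pts).
have szt: size t = size s by apply: perm_size.
rewrite -szt in re.
apply/setP => x; rewrite !inE /= iter_rot1; last by lia.
rewrite /rot takel_cat ?size_drop; last by lia.
apply/negP => /andP[xt /mem_take xD]; move: ut.
rewrite -[t in uniq t](cat_take_drop e) cat_uniq => /and3P[_ /hasPn tD _].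
move/negP: (tD x xD); apply => /=.
have: x \in take r (take e t) by rewrite take_takel //; lia.
by move/mem_take.
Qed.

End Arcs.

(** * Double counting over the orders of a set *)

Section ErdosKoRado.

Context {T : finType} (D : {set T}) (r : nat).
Implicit Types (A B S : {set T}) (F : {set {set T}}).

(** Linear arrangements of [D]: a cyclic order is counted once for each starting point. *)
Definition orders : {set #|D|.-tuple T} :=
  [set t : #|D|.-tuple T | perm_eq t (enum D)].

Definition orders_from A : {set #|D|.-tuple T} :=
  [set t in orders | arc r t 0 == A].

Lemma card_arc (t : #|D|.-tuple T) j :
  r <= #|D| -> t \in orders -> #|arc r t j| = r /\ arc r t j \subset D.
Proof.
rewrite inE => rD pt; have pj := perm_trans (perm_iter_rot1 j t) pt.
split.
  rewrite /arc cardsE (card_uniqP _) ?size_takel //.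
    by rewrite (perm_size pj) -cardE.
  by rewrite take_uniq // (perm_uniq pj) enum_uniq.
by apply/subsetP => x; rewrite inE => /mem_take; rewrite (perm_mem pj) mem_enum.
Qed.

(** A bijection of [D] carrying [A] onto [B] acts injectively on the orders. It is obtained by
    listing [D] with [A] first, respectively with [B] first, and matching positions. *)
Lemma card_orders_from_le A B :
  A \subset D -> B \subset D -> #|A| = #|B| ->
  #|orders_from A| <= #|orders_from B|.
Proof.
move=> AD BD cAB.
pose l S := enum S ++ enum (D :\: S).
have lP S : S \subset D -> perm_eq (l S) (enum D).
  move=> SD; apply: uniq_perm; rewrite ?enum_uniq //.
    rewrite cat_uniq !enum_uniq andbT; apply/hasPn => x.
    by rewrite !mem_enum inE => /andP[].
  move=> x; rewrite mem_cat !mem_enum !inE; case xS: (x \in S) => //=.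
  by rewrite (subsetP SD).
(* [x0] is only the default value for [nth]; if [D] is empty, so are [A] and [B]. *)
have [x0 _|D0] := pickP (mem D); last first.
  have S0 S : S \subset D -> S = set0.
    move=> SD; apply/setP => x; rewrite inE; apply/negP => /(subsetP SD).
    by rewrite -[_ \in _]/(mem D x) D0.
  by rewrite (S0 A AD) (S0 B BD).
pose f x := nth x0 (l B) (index x (l A)).
have uA: uniq (l A) by rewrite (perm_uniq (lP A AD)) enum_uniq.
have uB: uniq (l B) by rewrite (perm_uniq (lP B BD)) enum_uniq.
have szl: size (l A) = size (l B).
  by rewrite (perm_size (lP A AD)) (perm_size (lP B BD)).
have fl: map f (l A) = l B.
  apply: (@eq_from_nth _ x0); rewrite size_map // => i iA.
  by rewrite (nth_map x0) // /f index_uniq.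
have finj: {in l A &, injective f}.
  move=> x y xA yA /eqP; rewrite nth_uniq -?szl ?index_mem // => /eqP eqi.
  by rewrite -(nth_index x0 xA) eqi nth_index.
have memA x : (x \in l A) = (x \in D) by rewrite (perm_mem (lP A AD)) mem_enum.
have fA: f @: A = B.
  apply/eqP; rewrite eqEcard card_in_imset ?cAB ?leqnn ?andbT.
    apply/subsetP => _ /imsetP[x xA ->].
    have xi: index x (enum A) < size (enum A) by rewrite index_mem mem_enum.
    rewrite /f /l index_cat mem_enum xA nth_cat -cardE -cAB cardE xi.
    by rewrite -mem_enum mem_nth // -cardE -cAB cardE.
  by move=> x y xA yA; apply: finj; rewrite memA (subsetP AD).
have permf: perm_eq (map f (enum D)) (enum D).
  by apply: perm_trans (lP B BD); rewrite -fl perm_map // perm_sym lP.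
rewrite -(card_in_imset (f := map_tuple f) (D := orders_from A)).
  apply/subset_leq_card/subsetP => _ /imsetP[t + ->]; rewrite !inE.
  move=> /andP[pt /eqP At].
  apply/andP; split; first exact: perm_trans (perm_map f pt) permf.
  apply/eqP; rewrite -[RHS]fA -[in RHS]At; apply/setP => y; rewrite !inE /= -map_take.
  apply/mapP/imsetP => -[x xt ->]; exists x => //; first by rewrite inE.
  by rewrite inE in xt.
move=> t t'; rewrite !inE => /andP[pt _] /andP[pt' _] /(congr1 val) /= eqf.
have inA (u : #|D|.-tuple T) : perm_eq u (enum D) -> all (mem (l A)) u.
  by move=> pu; apply/allP => x xu; rewrite /= memA -mem_enum -(perm_mem pu).
apply: val_inj; apply: (inj_in_map finj _ _ eqf); exact: inA.
Qed.

Lemma card_orders_from A B :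
  A \subset D -> B \subset D -> #|A| = #|B| ->
  #|orders_from A| = #|orders_from B|.
Proof.
by move=> AD BD cAB; apply/eqP; rewrite eqn_leq !card_orders_from_le.
Qed.

Lemma sum_orders_first F :
  \sum_(t in orders) (arc r t 0 \in F) = \sum_(A in F) #|orders_from A|.
Proof.
have E A : #|orders_from A| = \sum_(t in orders) (arc r t 0 == A).
  pose P (t : #|D|.-tuple T) := arc r t 0 == A.
  rewrite -sum1_card -(big_mkcondr _ _ _ P (fun=> 1)).
  by apply: eq_bigl => t; rewrite inE.
under [RHS]eq_bigr => A _ do rewrite E.
rewrite [RHS]exchange_big /=; apply: eq_bigr => t _.
rewrite -big_mkcondr sum1_card.
case tF: (arc r t 0 \in F).
  rewrite (eq_card (B := pred1 (arc r t 0))) ?card1 // => A.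
  by rewrite unfold_in !inE /= [RHS]eq_sym; case: eqP => [<-|_]; rewrite ?tF ?andbF.
rewrite eq_card0 // => A; rewrite unfold_in; apply/andP => -[AF /eqP e].
by rewrite e AF in tF.
Qed.

(* Rotations permute the orders, so every position contributes equally. *)
Lemma sum_orders F :
  \sum_(t in orders) \sum_(j < #|D|) (arc r t j \in F) =
  #|D| * \sum_(t in orders) (arc r t 0 \in F).
Proof.
rewrite exchange_big /=.
rewrite (eq_bigr (fun=> \sum_(t in orders) (arc r t 0 \in F))).
  by rewrite sum_nat_const card_ord.
move=> j _; pose rot1 (t : #|D|.-tuple T) := [tuple of rot 1 t].
pose rotj (t : #|D|.-tuple T) := iter j rot1 t.
have rotjE t : rotj t = iter j (rot 1) t :> seq T.
  by rewrite /rotj; elim: (nat_of_ord j) => //= i ->.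
have rotj_inj : injective rotj.
  move=> t t' /(congr1 val); rewrite /= !rotjE => e; apply: val_inj => /=.
  by elim: (nat_of_ord j) e => //= i IHi /rot_inj.
rewrite [RHS](reindex_inj rotj_inj); apply: eq_big => t.
  by rewrite !inE rotjE (permPl (perm_iter_rot1 j t)).
by move=> _; rewrite rotjE -arcD.
Qed.

Lemma orders_nonempty : 0 < #|orders|.
Proof.
have szD: size (enum D) == #|D| by rewrite cardE.
by apply/card_gt0P; exists (Tuple szD); rewrite inE.
Qed.

(** [c] is in effect [r! (#|D| - r)!]; it cancels in the double counting, so only its positivity is
    recorded. *)
Lemma orders_count :
  r <= #|D| -> exists2 c, 0 < c &
  #|orders| = 'C(#|D|, r) * c /\
  forall A, A \subset D -> #|A| = r -> #|orders_from A| = c.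
Proof.
move=> rD; have: 0 < #|[set A : {set T} | A \subset D & #|A| == r]|.
  by rewrite cards_draws bin_gt0.
case/card_gt0P => A0; rewrite inE => /andP[A0D /eqP cA0].
have cE A : A \subset D -> #|A| = r -> #|orders_from A| = #|orders_from A0|.
  by move=> AD cA; apply: card_orders_from; rewrite ?cA.
have O_E: #|orders| = 'C(#|D|, r) * #|orders_from A0|.
  (* With all [r]-subsets of [D] as the family, every order has its first arc in it. *)
  transitivity (\sum_(t in orders)
      (arc r t 0 \in [set A : {set T} | A \subset D & #|A| == r])).
    rewrite -sum1_card; apply: eq_bigr => t tO; rewrite inE.
    by have [-> ->] := @card_arc t 0 rD tO; rewrite eqxx.
  rewrite sum_orders_first -cards_draws -sum_nat_const.
  by apply: eq_bigr => A; rewrite inE => /andP[AD /eqP]; apply: cE.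
exists #|orders_from A0| => //.
by have := orders_nonempty; rewrite O_E muln_gt0 => /andP[].
Qed.

Variable (F : {set {set T}}).
Hypotheses (r_gt0 : 0 < r) (lt2rD : 2 * r < #|D|).
Hypotheses (F_sub : forall A, A \in F -> A \subset D).
Hypotheses (F_card : forall A, A \in F -> #|A| = r) (F_int : intersecting F).

Lemma order_sparse t a : t \in orders -> forall j e, r <= e <= #|D| - r ->
  arc r t (a + j) \in F -> arc r t (a + (j + e)) \notin F.
Proof.
rewrite inE => pt j e re Fj; apply/negP => /(F_int _ _ Fj).
by rewrite addnA arc_disjoint ?eqxx // ?size_tuple // (perm_uniq pt) enum_uniq.
Qed.

Lemma order_sum_shift (t : #|D|.-tuple T) a :
  \sum_(j < #|D|) (arc r t j \in F) = \sum_(j < #|D|) (arc r t (a + j) \in F).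
Proof.
rewrite (@periodic_sum (fun j => arc r t j \in F)) // => j.
by rewrite -[X in j + X](size_tuple t) arc_periodic.
Qed.

(** Katona's lemma: the order is read from an arc of the family, so that position 0 is occupied. *)
Lemma order_sum_le t : t \in orders -> \sum_(j < #|D|) (arc r t j \in F) <= r.
Proof.
move=> tO; case: (pickP (fun j : 'I_#|D| => arc r t j \in F)) => [a Fa|F0].
  rewrite (order_sum_shift t a).
  apply: (@cyclic_sum_le _ _ (fun j => arc r t (a + j) \in F)) => //.
  - by lia.
  - by move=> j e; apply: order_sparse.
  - by rewrite addn0.
by rewrite big1 // => j _; rewrite F0.
Qed.

Lemma EKR_count : exists2 c, 0 < c &
  #|orders| = 'C(#|D|, r) * c /\
  \sum_(t in orders) \sum_(j < #|D|) (arc r t j \in F) = #|D| * (#|F| * c).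
Proof.
have rD: r <= #|D| by lia.
have [c c0 [Oc cE]] := orders_count rD; exists c => //; split=> //.
rewrite sum_orders sum_orders_first -[#|F| * c]sum_nat_const; congr (_ * _).
by apply: eq_bigr => A AF; apply: cE; [apply: F_sub|apply: F_card].
Qed.

Lemma bin_absorb : r * 'C(#|D|, r) = #|D| * 'C(#|D| - 1, r - 1).
Proof. by rewrite !subn1 mul_bin_diag prednK. Qed.

Theorem EKR : #|F| <= 'C(#|D| - 1, r - 1).
Proof.
have [c c0 [Oc sumE]] := EKR_count.
have: #|D| * (#|F| * c) <= #|orders| * r.
  rewrite -sumE -sum_nat_const; apply: leq_sum => t; exact: order_sum_le.
by rewrite Oc mulnAC [_ * r]mulnC bin_absorb mulnA leq_pmul2r // leq_pmul2l //; lia.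
Qed.

(** * The equality case *)

Hypothesis F_max : #|F| = 'C(#|D| - 1, r - 1).

(** The bounds [order_sum_le] add up to an equality, so each of them is an equality. *)
Lemma order_sum_max t : t \in orders -> \sum_(j < #|D|) (arc r t j \in F) = r.
Proof.
have [c c0 [Oc sumE]] := EKR_count.
move=> tO; apply/eqP; move: tO; apply/implyP; move: t; apply/forallP.
have /leqifP := leqif_sum (fun t tO => leqif_eq (order_sum_le t tO)).
rewrite sumE sum_nat_const Oc mulnAC [_ * r]mulnC bin_absorb -F_max mulnA.
by case: ifP => //; rewrite ltnn.
Qed.

Lemma arc_cat (l1 l2 l3 : seq T) i j : size l1 = j -> size l2 = i ->
  arc i (l1 ++ l2 ++ l3) j = [set x in l2].
Proof.
move=> <- <-; rewrite /arc iter_rot1 ?size_cat ?leq_addr //.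
by rewrite rot_size_cat -catA take_size_cat.
Qed.

(** Exactly [r] of the [#|D|] arcs lie in [F], and [0 < r < #|D|], so going around the order one
    passes from an arc outside [F] to an arc inside. *)
Lemma order_step (t : #|D|.-tuple T) : t \in orders ->
  exists b, arc r t b \notin F /\ arc r t b.+1 \in F.
Proof.
move=> tO; have sumF := order_sum_max t tO.
have [a Fa]: exists a : 'I_#|D|, arc r t a \in F.
  apply/existsP/contraT => /existsPn Fn; move: sumF; rewrite big1 => [|j _].
    by lia.
  by rewrite (negPf (Fn j)).
have [b Fb]: exists b : 'I_#|D|, arc r t b \notin F.
  apply/existsP/contraT => /existsPn Fn; move: sumF.
  under eq_bigr => j _ do rewrite (negbNE (Fn j)).
  by rewrite sum_nat_const card_ord; lia.
(* One full turn is added so that the arc in [F] comes after [b]. *)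
have [i abi]: exists i, a + #|D| = b + i.
  by exists (a + #|D| - b); have := ltn_ord b; lia.
have {a Fa abi} Fi: arc r t (b + i) \in F.
  by rewrite -abi -[X in a + X](size_tuple t) arc_periodic.
elim: i Fi => [|i IHi]; first by rewrite addn0 (negPf Fb).
rewrite addnS; case Fbi: (arc r t (b + i) \in F); first by move: IHi => /(_ Fbi).
by move=> Fi; exists (b + i); rewrite Fbi.
Qed.

(** [A] is the arc entering [F] in [order_step]; its predecessor gains the preceding element [q] and
    loses the last element [p] of [A]. *)
Lemma EKR_swap : exists A p q,
  [/\ A \in F, p \in A, q \in D, q \notin A & q |: (A :\ p) \notin F].
Proof.
have /card_gt0P[t0 t0O] := orders_nonempty.
have [b []] := order_step t0 t0O; rewrite -[b]add0n -addSn !arcD => Fq FA.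
have pt : perm_eq (iter b (rot 1) t0) (enum D).
  by apply: perm_trans (perm_iter_rot1 b t0) _; rewrite inE in t0O.
have sizet : size (iter b (rot 1) t0) = #|D| by rewrite (perm_size pt) cardE.
move: pt sizet Fq FA; case: (iter b _ _) => [|q u] /=; first by lia.
move=> pt szu; have szu1: r.-1 < size u by lia.
have uqu: uniq (q :: u) by rewrite (perm_uniq pt) enum_uniq.
have eqS: q :: u = [::] ++ (q :: take r.-1 u) ++ drop r.-1 u.
  by rewrite /= cat_take_drop.
have eqA: q :: u = [:: q] ++ take r u ++ drop r u by rewrite cat_take_drop.
have -> : arc r (q :: u) 0 = [set x in q :: take r.-1 u].
  by rewrite [LHS](congr1 (fun v => arc r v 0) eqS) arc_cat //= size_takel; lia.
have -> : arc r (q :: u) 1 = [set x in take r u].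
  by rewrite [LHS](congr1 (fun v => arc r v 1) eqA) arc_cat // size_takel; lia.
have eqT : take r u = rcons (take r.-1 u) (nth q u r.-1).
  by rewrite -take_nth // prednK.
set p := nth q u r.-1 in eqT => Fq FA.
exists [set x in take r u], p, q; split=> //.
- by rewrite inE eqT mem_rcons mem_head.
- by rewrite -mem_enum -(perm_mem pt) mem_head.
- by rewrite inE; apply/negP => /mem_take; case/andP: uqu => /negP.
have/= /andP[_ uu] := uqu.
have: uniq (take r u) by rewrite take_uniq.
rewrite eqT rcons_uniq => /andP[pn _].
suff -> : q |: ([set x in rcons (take r.-1 u) p] :\ p) = [set x in q :: take r.-1 u].
  by [].
apply/setP => x; rewrite !inE mem_rcons inE; case: eqP => //= _.
by case: eqP => //= ->; rewrite (negPf pn).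
Qed.

(* A cyclic order in which [q], [A :\: S], [A :&: S] (ending with [p]) and [S :\: A]
   are consecutive has the arc [A] in [F], its predecessor outside [F], and [S] among
   the [r - 1] arcs following [A]. *)
Lemma EKR_exchange A p q S :
  A \in F -> p \in A -> q \in D -> q \notin A -> q |: (A :\ p) \notin F ->
  S \subset D -> #|S| = r -> p \in S -> q \notin S -> S \in F.
Proof.
move=> FA pA qD qA Fq SD cS pS qS.
have AD := F_sub A FA; have cA := F_card A FA.
have qp : (q == p) = false by apply/eqP => e; rewrite e pA in qA.
pose l1 := enum (A :\: S); pose l2 := enum ((A :&: S) :\ p).
pose l3 := enum (S :\: A); pose l4 := enum (D :\: (q |: (A :|: S))).
pose s := q :: l1 ++ l2 ++ p :: l3 ++ l4.
have ps : perm_eq s (enum D).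
  apply: uniq_perm; rewrite ?enum_uniq //.
    rewrite /= !cat_uniq /= cat_uniq !enum_uniq /= !andbT.
    apply/and5P; split.
    - rewrite !mem_cat inE !mem_cat !mem_enum !inE eqxx (negPf qA) (negPf qS).
      by rewrite qp !andbF.
    - apply/hasPn => x; rewrite mem_cat inE mem_cat !mem_enum !inE.
      case: eqP => [->|_] /=; first by rewrite pS.
      by case: (x \in A) (x \in S) => -[] //=; rewrite ?orbT ?andbF.
    - rewrite mem_enum !inE eqxx /=; apply/hasPn => x; rewrite mem_cat !mem_enum !inE.
      by case: (x \in A) (x \in S) => -[] //=; rewrite ?orbT ?andbF.
    - by rewrite mem_cat !mem_enum !inE pA pS /= orbT.
    apply/hasPn => x; rewrite !mem_enum !inE.
    by case: (x \in A) (x \in S) => -[] //=; rewrite ?orbT ?andbF.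
  move=> x; rewrite inE !mem_cat inE mem_cat !mem_enum !inE.
  case: eqP => [->|_] /=; first by rewrite qD.
  case: eqP => [->|_] /=; first by rewrite (subsetP SD) // !orbT.
  have := subsetP AD x; have := subsetP SD x.
  by case: (x \in A) (x \in S) (x \in D) => -[] [] //= h1 h2;
    try (have := h1 isT); try (have := h2 isT).
have szs : size s == #|D| by rewrite (perm_size ps) cardE.
have tO : Tuple szs \in orders by rewrite inE.
(* The shift by 1 places [A] at position 0 and its predecessor at position [#|D| - 1]. *)
pose X j := arc r s (1 + j) \in F.
have sz (B : {set T}) : size (enum B) = #|B| by symmetry; apply: cardE.
have cl12 : size l1 + size l2 = r.-1.
  have := cardsID S A; rewrite (cardsD1 p (A :&: S)) !inE pA pS cA.
  by rewrite /l1 /l2 !sz => e; clear -e; lia.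
have cl23 : size l2 + size l3 = r.-1.
  have := cardsID A S; rewrite setIC (cardsD1 p (A :&: S)) !inE pA pS cS.
  by rewrite /l2 /l3 !sz => e; clear -e; lia.
have arcA : arc r s 1 = A.
  have ->: s = [:: q] ++ (l1 ++ l2 ++ [:: p]) ++ l3 ++ l4 by rewrite /s /= -!catA.
  rewrite arc_cat //; last by rewrite !size_cat addnA cl12 addn1 prednK.
  apply/setP => x.
  rewrite inE !mem_cat !mem_enum !inE.
  by case: eqP => [->|_]; rewrite ?pA ?orbT //; case: (x \in A) (x \in S) => -[].
have arcq : arc r s 0 = q |: (A :\ p).
  have ->: s = [::] ++ (q :: l1 ++ l2) ++ p :: l3 ++ l4 by rewrite /s /= -!catA.
  rewrite arc_cat //; last by rewrite /= size_cat cl12 prednK.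
  apply/setP => x.
  rewrite !inE !mem_cat !mem_enum !inE.
  case: (x =P p) => [->|_]; rewrite ?pA ?pS ?orbT //=.
  by case: (x \in A) (x \in S) => -[]; rewrite ?orbT ?orbF.
have arcS : arc r s (1 + size l1) = S.
  have ->: s = (q :: l1) ++ (l2 ++ p :: l3) ++ l4 by rewrite /s /= -!catA.
  rewrite arc_cat //; last by rewrite size_cat /= addnS cl23 prednK.
  apply/setP => x.
  rewrite !inE mem_cat inE !mem_enum !inE.
  by case: eqP => [->|_]; rewrite ?pS ?orbT //; case: (x \in A) (x \in S) => -[].
rewrite -arcS; apply: (@cyclic_interval_full #|D| r X) => //.
- exact: ltnW.
- exact: (order_sparse (Tuple szs) 1 tO).
- by rewrite /X addn0 arcA.
- rewrite /X add1n prednK; last exact: leq_trans lt2rD.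
  by rewrite -(eqP szs) -[size s]add0n arc_periodic arcq.
- by rewrite -(order_sum_shift (Tuple szs) 1) order_sum_max.
by rewrite -(prednK r_gt0) ltnS -cl12 leq_addr.
Qed.

(** If [B] in [F] missed [p], there would be room in [D] for [r - 1] points outside [B], [p] and
    [q], as [#|D| - (r + 2) >= r - 1]. Together with [p] they form a member of [F] by
    [EKR_exchange], disjoint from [B]. *)
Lemma EKR_max_meet : exists2 p, p \in D & forall B, B \in F -> p \in B.
Proof.
have [A [p [q [FA pA qD qA Fq]]]] := EKR_swap.
exists p => [|B FB]; first by apply: (subsetP (F_sub A FA)).
apply: contraT => pB.
have: 0 < #|[set S : {set T} | S \subset D :\: (B :|: [set p; q]) & #|S| == r.-1]|.
  rewrite cards_draws bin_gt0.
  have := cardsU B [set p; q]; have := F_card B FB; have := cards2 p q.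
  have := cardsD D (B :|: [set p; q]).
  have := subset_leq_card (subsetIr D (B :|: [set p; q])).
  by lia.
case/card_gt0P => S; rewrite inE => /andP[SD /eqP cS].
have pS: p \notin S by apply/negP => /(subsetP SD); rewrite !inE eqxx orbT.
have FS: p |: S \in F.
  apply: (EKR_exchange A p q) => //.
  - rewrite subUset sub1set (subsetP (F_sub A FA)) //=.
    by apply: subset_trans SD (subsetDl _ _).
  - by rewrite cardsU1 pS cS; lia.
  - by rewrite setU11.
  rewrite !inE negb_or; apply/andP; split.
    by apply: contraNneq qA => ->.
  by apply/negP => /(subsetP SD); rewrite !inE eqxx !orbT.
have /set0Pn[x] := F_int _ _ FB FS.
rewrite !inE => /andP[xB /orP[/eqP xp|/(subsetP SD)]].
  by rewrite -xp xB in pB.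
by rewrite !inE xB.
Qed.

End ErdosKoRado.

Theorem EKR_unique {T : finType} (D : {set T}) (r : nat) (F : {set {set T}}) :
  0 < r -> 2 * r < #|D| -> (forall A, A \in F -> A \subset D) ->
  (forall A, A \in F -> #|A| = r) -> intersecting F ->
  #|F| = 'C(#|D| - 1, r - 1) ->
  exists2 p, p \in D & F = [set A : {set T} | [&& A \subset D, #|A| == r & p \in A]].
Proof.
move=> r0 rD FD Fr FI Fmax.
have [p pD pF] := EKR_max_meet D r F r0 rD FD Fr FI Fmax.
exists p => //; apply/eqP; rewrite eqEcard; apply/andP; split.
  by apply/subsetP => A FA; rewrite inE FD // Fr // eqxx pF.
(* The star of [p] is itself intersecting, so [EKR] bounds its size by that of [F]. *)
rewrite Fmax; apply: EKR => // [A|A|A B]; rewrite !inE.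
- by case/and3P.
- by case/and3P => _ /eqP.
move=> /and3P[_ _ pA] /and3P[_ _ pB].
by apply/set0Pn; exists p; rewrite inE pA.
Qed.

(** * Popular traces *)

Lemma leq_bin_half N i j : i <= j -> 2 * j <= N.+1 -> 'C(N, i) <= 'C(N, j).
Proof.
elim: j => [|j IHj]; first by rewrite leqn0 => /eqP->.
rewrite leq_eqVlt => /orP[/eqP->//|ij] jN.
apply: (leq_trans (IHj _ _)); [by []|by lia|].
have := mul_bin_left N j; have: j.+1 <= N - j by lia.
by nia.
Qed.

(** The ratio of the two binomials is [(N - s) / (s + 1)]. *)
Lemma bin_dominate N s c : c * s.+1 < N - s -> c * 'C(N, s) < 'C(N, s.+1).
Proof.
move=> cN; have bin0: 0 < 'C(N, s) by rewrite bin_gt0; lia.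
rewrite -(ltn_pmul2l (ltn0Sn s)) mul_bin_left mulnA ltn_pmul2r //.
by rewrite mulnC.
Qed.

Lemma card_draws_mem {T : finType} (H : {set T}) s x :
  #|[set B : {set T} | [&& B \subset H, #|B| == s & x \in B]]| <= 'C(#|H|, s.-1).
Proof.
rewrite -cards_draws -(card_in_imset (f := fun B => B :\ x)).
  apply/subset_leq_card/subsetP => C /imsetP[B + ->].
  rewrite !inE => /and3P[BH /eqP cB xB].
  rewrite (subset_trans (subsetDl _ _) BH) -cB (cardsD1 x B) xB /=.
  by rewrite eqxx.
move=> B B'; rewrite !inE => /and3P[_ _ xB] /and3P[_ _ xB'] e.
by rewrite -(setD1K xB) -(setD1K xB') e.
Qed.

Lemma highsetE m n : highset m n = ~: lowset m n.
Proof. by apply/setP => i; rewrite !inE leqNgt. Qed.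

Lemma card_lowset m n : n <= m -> #|lowset m n| = n.
Proof.
move=> nm; rewrite -sum1dep_card -(big_ord_widen _ (fun=> 1) nm).
by rewrite sum1_card card_ord.
Qed.

Lemma card_highset m n : n <= m -> #|highset m n| = m - n.
Proof. by move=> nm; rewrite highsetE cardsCs setCK card_ord card_lowset. Qed.

Lemma low_high_card m n (X : {set 'I_m}) :
  #|X :&: lowset m n| + #|X :&: highset m n| = #|X|.
Proof. by rewrite highsetE -setDE cardsID. Qed.

Lemma low_high_cover m n (X : {set 'I_m}) :
  (X :&: lowset m n) :|: (X :&: highset m n) = X.
Proof. by rewrite highsetE -setDE setID. Qed.

(** * Members of the family grouped by their trace on [[n]] *)

Section Fibres.

Variables (m n k : nat) (F : {set {set 'I_m}}).
Hypotheses (kn : k <= n) (nk : n < 2 * k - 3) (nm : n <= m).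
Hypothesis F_mnk : mnk_family m n k F.

Notation L := (lowset m n).
Notation H := (highset m n).
Notation N := (m - n).
Notation r := (n - k + 1).
Notation s := (2 * k - n - 1).

Definition fibre (A : {set 'I_m}) : {set {set 'I_m}} := [set X in F | X :&: L == A].

Lemma fibre_high_inj A : {in fibre A &, injective (fun X => X :&: H)}.
Proof.
move=> X Y; rewrite !inE => /andP[_ /eqP XA] /andP[_ /eqP YA] e.
by rewrite -(low_high_cover m n X) -(low_high_cover m n Y) XA YA e.
Qed.

Lemma fibre_high A X : X \in fibre A -> #|X :&: H| = k - #|A|.
Proof.
rewrite inE => /andP[FX /eqP <-]; case: F_mnk => _ [_ /(_ X FX) <-].
by rewrite -(low_high_card m n X) addKn.
Qed.

Lemma card_fibre_le A : #|fibre A| <= 'C(N, k - #|A|).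
Proof.
rewrite -(card_in_imset (fibre_high_inj A)) -(card_highset m n nm) -cards_draws.
apply/subset_leq_card/subsetP => B /imsetP[X XA ->].
by rewrite inE subsetIr (fibre_high A X XA) /=.
Qed.

Lemma card_fibre_mem A x : x \in H ->
  #|[set X in fibre A | x \in X]| <= 'C(N, (k - #|A|).-1).
Proof.
move=> xH; rewrite -(card_in_imset (f := fun X => X :&: H)); last first.
  move=> X Y; rewrite !in_set => /andP[XA _] /andP[YA _].
  by apply: (fibre_high_inj A); rewrite in_set.
apply: leq_trans (_ : _ <= 'C(#|H|, (k - #|A|).-1)) _; last by rewrite card_highset.
apply: leq_trans (card_draws_mem H (k - #|A|) x).
apply/subset_leq_card/subsetP => B /imsetP[X + ->].
rewrite [in X in X -> _]in_set => /andP[XA xX].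
by rewrite in_set subsetIr (fibre_high A X XA) eqxx in_setI xX xH.
Qed.

(** Union bound: each point of [Y] outside [[n]] lies in at most ['C(N, k - #|A| - 1)] members with
    trace [A]. *)
Lemma fibre_avoid (A Y : {set 'I_m}) : #|Y :&: H| * 'C(N, (k - #|A|).-1) < #|fibre A| ->
  exists2 X, X \in fibre A & [disjoint X :&: H & Y].
Proof.
move=> big; apply/exists_inP/contraT; rewrite negb_exists_in => /forall_inP meet.
move: big; rewrite ltnNge => /negP[].
apply: (@leq_trans (\sum_(x in Y :&: H) #|[set X in fibre A | x \in X]|)); last first.
  rewrite -sum_nat_const; apply: leq_sum => x; rewrite inE => /andP[_ xH].
  exact: card_fibre_mem.
apply: (@leq_trans #|\bigcup_(x in Y :&: H) [set X in fibre A | x \in X]|).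
  apply/subset_leq_card/subsetP => X XA.
  have := meet X XA; rewrite -setI_eq0 => /set0Pn[x]; rewrite !inE -andbA.
  move=> /and3P[xX xH xY]; apply/bigcupP; exists x; first by rewrite !inE xY.
  by rewrite in_set XA.
elim/big_rec2: _ => [|x a B _ le]; first by rewrite cards0.
by apply: leq_trans (leq_card_setU _ _) _; rewrite leq_add2l.
Qed.

Lemma low_card_ge Y : Y \in F -> r <= #|Y :&: L|.
Proof.
move=> FY; rewrite leqNgt; apply/negP => lt.
case: F_mnk => [F_int [base_sub _]].
have: 0 < #|[set S : {set 'I_m} | S \subset L :\: Y & #|S| == k]|.
  rewrite cards_draws bin_gt0 cardsD setIC card_lowset //.
  by move: lt; set a := #|_|; move: kn nk; clear; lia.
case/card_gt0P => S; rewrite inE subsetD -andbA => /and3P[SL SY cS].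
have FS: S \in F by apply: (subsetP base_sub); rewrite inE SL.
by have := F_int _ _ FS FY; rewrite setI_eq0 SY.
Qed.

Lemma high_card_le Y : Y \in F -> #|Y :&: H| <= s.
Proof.
move=> FY; have := low_card_ge Y FY; have := low_high_card m n Y.
case: F_mnk => _ [_ /(_ Y FY) ->]; set a := #|_|; set b := #|_|.
by move: kn nk; clear; lia.
Qed.

(** A member has at most [s] points outside [[n]], so [theta] bounds the number of members with a
    given [r]-element trace that meet it there. *)
Notation theta := (s * 'C(N, s - 1)).

Definition popular : {set {set 'I_m}} :=
  [set A : {set 'I_m} | [&& A \subset L, #|A| == r & theta < #|fibre A|]].

Lemma popular_meets A Y : A \in popular -> Y \in F -> A :&: Y != set0.
Proof.
rewrite inE => /and3P[AL /eqP cA big] FY.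
have [|X XA dis] := fibre_avoid A Y.
  apply: leq_ltn_trans big; rewrite cA.
  have ->: (k - r).-1 = s - 1 by move: kn nk; clear; lia.
  by rewrite leq_mul2r high_card_le ?orbT.
move: XA; rewrite inE => /andP[FX /eqP XA].
case: F_mnk => F_int _; have /set0Pn[x] := F_int _ _ FX FY.
rewrite -{1}(low_high_cover m n X) XA setIUl inE => /orP[xA|].
  by apply/set0Pn; exists x.
by move: dis; rewrite -setI_eq0 => /eqP->; rewrite inE.
Qed.

Lemma popular_intersecting : intersecting popular.
Proof.
move=> A B PA PB; have: 0 < #|fibre B|.
  by move: PB; rewrite inE => /and3P[_ _]; apply: leq_ltn_trans.
case/card_gt0P => X; rewrite inE => /andP[FX /eqP XB].
have := popular_meets A X PA FX; rewrite -XB setIA.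
move: PA; rewrite inE => /andP[/setIidPl AL _].
by rewrite setIAC AL.
Qed.

(** Traces with fewer than [r] points do not occur, those with [r] points satisfy the bound by
    definition, and larger ones leave at most [s - 1] points to choose outside [[n]], where
    binomials still increase. *)
Lemma card_unpopular (A : {set 'I_m}) : 2 * s <= N -> A \subset L -> A \notin popular ->
  #|fibre A| <= theta.
Proof.
move=> sN AL; rewrite inE AL /=; have [cA|cA _] := eqVneq #|A| r.
  by rewrite -leqNgt.
have [-> |/set0Pn[X XA]] := eqVneq (fibre A) set0; first by rewrite cards0.
have: r <= #|A|.
  by move: XA; rewrite inE => /andP[FX /eqP <-]; apply: low_card_ge.
move=> rA; apply: (leq_trans (card_fibre_le A)).
apply: (@leq_trans 'C(N, s - 1)).
  by apply: leq_bin_half; move: kn nk sN cA rA; clear; lia.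
by apply: leq_pmull; move: nk kn; clear; lia.
Qed.

(** The members are summed over their traces: a popular one carries at most ['C(N, s)], and at most
    [2 ^ n] are unpopular. *)
Lemma card_family_le : 2 * s <= N ->
  #|F| <= #|popular| * 'C(N, s) + 2 ^ n * theta.
Proof.
move=> sN.
have ->: #|F| = \sum_(A in powerset L) #|fibre A|.
  rewrite -sum1_card (partition_big (fun X => X :&: L) (mem (powerset L))) /=.
    apply: eq_bigr => A _; rewrite -sum1_card; apply: eq_bigl => X.
    by rewrite inE.
  by move=> X _; rewrite inE subsetIr.
have -> : 2 ^ n = #|powerset L| by rewrite card_powerset card_lowset.
rewrite (bigID (mem popular)) /=; apply: leq_add.
  rewrite -sum_nat_const [X in X <= _](eq_bigl (mem popular)) /=.
    apply: leq_sum => A; rewrite inE => /and3P[_ /eqP cA _].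
    have -> : s = k - #|A| by rewrite cA; move: kn nk; clear; lia.
    exact: card_fibre_le.
  by move=> A; rewrite !inE; case: (A \subset L); rewrite ?andbF.
rewrite -sum_nat_const (bigID (mem popular) (mem (powerset L))) /=.
apply: (leq_trans _ (leq_addl _ _)); apply: leq_sum => A.
by rewrite [A \in powerset _]inE => /andP[AL]; apply: card_unpopular.
Qed.

Lemma card_popular : #|popular| <= 'C(n - 1, r - 1).
Proof.
rewrite -[in n - 1](card_lowset m n nm); apply: EKR.
- by rewrite addn1.
- by rewrite card_lowset //; move: kn nk; clear; lia.
- by move=> A; rewrite inE => /and3P[].
- by move=> A; rewrite inE => /and3P[_ /eqP].
exact: popular_intersecting.
Qed.

Lemma popular_star : #|popular| = 'C(n - 1, r - 1) ->
  exists2 t : 'I_m, t \in L &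
  forall Y, Y \in F -> ~~ (Y \subset L) -> t \in Y.
Proof.
rewrite -[in n - 1](card_lowset m n nm) => /EKR_unique[||A|A||t tL popE].
- by rewrite addn1.
- by rewrite card_lowset //; move: kn nk; clear; lia.
- by rewrite inE => /and3P[].
- by rewrite inE => /and3P[_ /eqP].
- exact: popular_intersecting.
exists t => // Y FY YL; apply: contraT => tY.
(* [Y] has a point outside [[n]], hence at most [k - 1] points inside, which leaves [n - k = r - 1]
   points for [S]; then [t |: S] is popular and disjoint from [Y]. *)
have: 0 < #|[set S : {set 'I_m} | S \subset (L :\ t) :\: Y & #|S| == n - k]|.
  rewrite cards_draws bin_gt0 cardsD setIC.
  have := cardsD1 t L; rewrite tL card_lowset //.
  have: #|Y :&: (L :\ t)| <= #|Y :&: L| by apply/subset_leq_card/setIS/subsetDl.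
  have: 0 < #|Y :&: H|.
    rewrite card_gt0 highsetE; apply: contraNneq YL => e.
    by rewrite -[L]setCK -disjoints_subset -setI_eq0 e.
  have := low_high_card m n Y; case: F_mnk => _ [_ /(_ Y FY) ->].
  set a := #|_|; set b := #|_|; set c := #|_|; set d := #|_|.
  by move: kn nk; clear; lia.
case/card_gt0P => S; rewrite inE !subsetD -!andbA => /and4P[SL tS SY cS].
have PS: t |: S \in popular.
  have tS' : t \notin S by rewrite -disjoints1 disjoint_sym.
  by rewrite popE inE setU11 subUset sub1set tL SL cardsU1 tS' (eqP cS) addnC eqxx.
have /set0Pn[x] := popular_meets _ Y PS FY; rewrite !inE => /andP[/orP[/eqP->|xS] xY].
  by rewrite xY in tY.
by move/pred0P/(_ x): SY; rewrite /= xS xY.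
Qed.

End Fibres.

(** * The extremal family *)

Lemma mem_bigcup_seqP {I : eqType} {T : finType} (E : I -> {set T}) (l : seq I) x :
  reflect (exists2 i, i \in l & x \in E i) (x \in \bigcup_(i <- l) E i).
Proof.
elim: l => [|j l IHl]; first by rewrite big_nil inE; apply: ReflectF => -[].
rewrite big_cons in_setU; apply: (iffP orP) => [[xj|/IHl[i il xi]]|[i]].
- by exists j; rewrite ?mem_head.
- by exists i; rewrite // inE il orbT.
by rewrite inE => /orP[/eqP-> |il] xi; [left|right; apply/IHl; exists i].
Qed.

Section ExtremalFamily.

Variables (m n k : nat).
Hypotheses (kn : k <= n) (nk : n < 2 * k - 3) (nm : n <= m).

Notation L := (lowset m n).
Notation H := (highset m n).
Notation N := (m - n).
Notation s := (2 * k - n - 1).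

Variable t : 'I_m.
Hypothesis tL : t \in L.

(** The term of index [i] in the union defining [Hfam]; [mem_layer] describes it by the number of
    points outside [[n]]. *)
Definition layer i : {set {set 'I_m}} :=
  [set A :|: B :|: [set t] | A in [set A : {set 'I_m} |
                                 (A \subset L :\ t) && (#|A| == k - i - 1)],
                             B in [set B : {set 'I_m} |
                                 (B \subset H) && (#|B| == i)]].

Lemma layer_cut (A B : {set 'I_m}) : A \subset L :\ t -> B \subset H ->
  (A :|: B :|: [set t]) :&: H = B /\ (A :|: B :|: [set t]) :&: L = t |: A.
Proof.
move=> AL BH.
(* For a point other than [t], the Booleans are membership in [B], in [A] and in [L]. *)
have close (b c l : bool) : (b -> ~~ l) -> (c -> l) ->
    (c || b) && ~~ l = b /\ (c || b) && l = c.
  by move=> /implyP + /implyP; case: b; case: c; case: l.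
have inL x : x \in A -> x \in L by move=> /(subsetP AL); rewrite in_setD1 => /andP[].
have notL x : x \in B -> x \notin L.
  by move=> /(subsetP BH); rewrite highsetE in_setC.
have tB : t \notin B := contraL (notL t) tL.
split; apply/setP => x.
  rewrite in_setI !in_setU in_set1 highsetE in_setC.
  have [->|_] := eqVneq x t; first by rewrite tL (negPf tB) andbF.
  by rewrite orbF (proj1 (close _ _ _ (notL x) (inL x))).
rewrite in_setI !in_setU !in_set1.
have [->|_] := eqVneq x t; first by rewrite tL orbT.
by rewrite orbF (proj2 (close _ _ _ (notL x) (inL x))).
Qed.

(** For [i < k] the difference [k - i - 1] is not truncated, so the sets of the layer have [k]
    elements. *)
Lemma mem_layer X i : i < k ->
  (X \in layer i) = [&& t \in X, #|X| == k & #|X :&: H| == i].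
Proof.
move=> ik; apply/imset2P/and3P => [[A B]|[tX /eqP cX /eqP cXH]].
  rewrite !in_set => /andP[AL /eqP cA] /andP[BH /eqP cB] ->.
  have [eH eL] := layer_cut A B AL BH; split.
  - by rewrite in_setU in_set1 eqxx orbT.
  - rewrite -(low_high_card m n) eH eL cB cardsU1 cA.
    have -> : t \notin A by apply/negP => /(subsetP AL); rewrite !inE eqxx.
    by apply/eqP; move: ik; clear; lia.
  by rewrite eH cB.
exists ((X :&: L) :\ t) (X :&: H).
- rewrite inE setSD ?subsetIr //=; apply/eqP.
  have := low_high_card m n X; rewrite cX cXH (cardsD1 t (X :&: L)) in_setI tX tL.
  by move: (#|_|) => a; move: ik; clear; lia.
- by rewrite inE subsetIr cXH /=.
by rewrite setUAC -[_ :|: [set t]]setUC setD1K ?low_high_cover // in_setI tX.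
Qed.

Lemma card_layer i : #|layer i| = 'C(n - 1, k - i - 1) * 'C(N, i).
Proof.
rewrite /layer curry_imset2X card_in_imset.
  rewrite cardsX !cards_draws card_highset //.
  suff -> : #|L :\ t| = n - 1 by [].
  by have := cardsD1 t L; rewrite tL card_lowset //; set a := #|_|; clear; lia.
move=> [A B] [A' B']; rewrite !in_setX !in_set /=.
move=> /andP[/andP[AL _] /andP[BH _]] /andP[/andP[AL' _] /andP[BH' _]] e.
have [eH eL] := layer_cut A B AL BH; have [eH' eL'] := layer_cut A' B' AL' BH'.
have tA : t \notin A by apply/negP => /(subsetP AL); rewrite !inE eqxx.
have tA' : t \notin A' by apply/negP => /(subsetP AL'); rewrite !inE eqxx.
congr (_, _); last by rewrite -eH -eH' e.
by rewrite -(setU1K tA) -(setU1K tA') -eL -eL' e.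
Qed.

Lemma mem_Hfam X : (X \in Hfam m n k t) =
  (X \in base m n k) || [&& t \in X, #|X| == k & 1 <= #|X :&: H| <= s].
Proof.
rewrite in_setU; congr orb; apply/mem_bigcup_seqP/idP => [[i]|/and3P[tX cX iX]].
  rewrite mem_index_iota => /andP[i0 il].
  rewrite mem_layer; last by move: kn nk il; clear; lia.
  by case/and3P=> -> -> /eqP->; rewrite i0 -ltnS.
exists #|X :&: H|; first by rewrite mem_index_iota ltnS.
rewrite mem_layer ?tX ?cX ?eqxx //.
by move: iX kn nk; set a := #|_|; clear; lia.
Qed.

(** The number of points outside [[n]] separates the layers from one another and, being positive,
    from [base]. *)
Lemma card_Hfam : #|Hfam m n k t| = h m n k.
Proof.
rewrite /Hfam -/(layer _) cardsU disjoint_setI0 ?cards0 ?subn0.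
  congr (_ + _); first by rewrite /base cards_draws card_lowset.
  have: (2 * k - n - 1).+1 <= k by move: kn nk; clear; lia.
  elim: (2 * k - n - 1) => [|l IHl] lk; first by rewrite !big_geq // cards0.
  rewrite !(big_nat_recr l.+1) //= cardsU disjoint_setI0 ?cards0 ?subn0.
    by rewrite IHl ?card_layer // ltnW.
  rewrite -setI_eq0; apply/set0Pn => -[X]; rewrite in_setI => /andP[].
  case/mem_bigcup_seqP => i; rewrite mem_index_iota => /andP[_ il].
  rewrite !mem_layer //; last by apply: leq_trans lk; apply: leqW.
  by move=> /and3P[_ _ /eqP->] /and3P[_ _ /eqP e]; rewrite e ltnn in il.
rewrite -setI_eq0; apply/set0Pn => -[X]; rewrite in_setI => /andP[].
rewrite inE => /andP[XL _] /mem_bigcup_seqP[i]; rewrite mem_index_iota => /andP[i0 il].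
rewrite mem_layer; last by move: kn nk il; clear; lia.
have -> : X :&: H = set0.
  by apply: disjoint_setI0; rewrite highsetE disjoints_subset setCK.
by rewrite cards0 => /and3P[_ _ /eqP e]; rewrite -e in i0.
Qed.

Lemma Hfam_mnk : mnk_family m n k (Hfam m n k t).
Proof.
have low X : X \in Hfam m n k t -> #|X| = k /\ k - s <= #|X :&: L|.
  have := low_high_card m n X; rewrite mem_Hfam.
  move=> e /orP[|/and3P[_ /eqP cX /andP[_ sX]]].
    rewrite inE => /andP[/setIidPl -> /eqP ->]; split=> //; exact: leq_subr.
  by split=> //; move: e sX; rewrite cX; set a := #|_|; set b := #|_|; clear; lia.
have meet X Y : X \in base m n k -> Y \in Hfam m n k t -> X :&: Y != set0.
  rewrite inE => /andP[XL /eqP cX] /low[cY lY].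
  apply/negP => /eqP XY.
  (* Pigeonhole in [[n]]: [k + (k - s) = n + 1]. *)
  have: #|X :|: (Y :&: L)| <= #|L| by rewrite subset_leq_card // subUset XL subsetIr.
  rewrite cardsU setIA XY set0I cards0 subn0 card_lowset // cX.
  by move: lY kn nk; set a := #|_|; clear; lia.
split; last split.
- move=> X Y FX FY; have [bX|bX] := boolP (X \in base m n k); first exact: meet.
  have [bY|bY] := boolP (Y \in base m n k); first by rewrite setIC meet.
  move: FX FY; rewrite !mem_Hfam (negPf bX) (negPf bY) => /and3P[tX _ _] /and3P[tY _ _].
  by apply/set0Pn; exists t; rewrite inE tX.
- exact: subsetUl.
by move=> X /low[].
Qed.

End ExtremalFamily.

(** * Families of maximum size for large [m] *)

Lemma mnk_familyP m n k F : reflect (mnk_family m n k F) (mnk_familyb m n k F).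
Proof.
apply: (iffP idP) => [/andP[/andP[/forall_inP FI bF] /forall_inP Fk]|[FI [bF Fk]]].
  split; last by split=> // A /Fk/eqP.
  by move=> A B FA FB; apply: (forall_inP (FI A FA)).
rewrite /mnk_familyb bF andbT; apply/andP; split.
  by apply/forall_inP => A FA; apply/forall_inP => B FB; apply: FI.
by apply/forall_inP => A /Fk ->.
Qed.

(** With fewer than ['C(n - 1, r - 1)] popular sets, the unpopular part is too small to make up for
    a missing ['C(m - n, s)], and [F] would have fewer than [h m n k] members. *)
Lemma mnk_family_star m n k F : k <= n -> n < 2 * k - 3 ->
  n + 2 * (2 * k - n - 1) + 2 ^ n * (2 * k - n - 1) ^ 2 <= m ->
  mnk_family m n k F -> h m n k <= #|F| ->
  exists2 t : 'I_m, t \in lowset m n & F \subset Hfam m n k t.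
Proof.
move=> kn nk Mm mnkF hF; have nm : n <= m by move: Mm; clear; lia.
have popF := card_popular m n k F kn nk nm mnkF.
set s := 2 * k - n - 1 in Mm.
have sN : 2 * s <= m - n by move: Mm; clear; lia.
have [popE|popN] := eqVneq #|popular m n k F| 'C(n - 1, n - k + 1 - 1).
  have [t tL Ft] := popular_star m n k F kn nk nm mnkF popE.
  exists t => //; apply/subsetP => X FX; rewrite mem_Hfam //.
  case: (mnkF) => _ [_ /(_ X FX) cX]; rewrite inE cX eqxx andbT /=.
  case XL: (X \subset _) => //=; rewrite Ft ?XL //= (high_card_le m n k F) // andbT.
  rewrite card_gt0 highsetE; apply: contraFneq XL => e.
  by rewrite -[lowset m n]setCK -disjoints_subset -setI_eq0 e.
suff: #|F| < h m n k by rewrite ltnNge hF.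
apply: (@leq_ltn_trans _ _ _ (card_family_le m n k F kn nk nm mnkF sN)).
(* This is what the summand [2 ^ n * s ^ 2] of the threshold is for; [2 * s] serves
   [card_family_le]. *)
have dom : 2 ^ n * s * 'C(m - n, s - 1) < 'C(m - n, s).
  have s0 : s = (s - 1).+1 by rewrite /s; move: kn nk; clear; lia.
  rewrite [X in _ < 'C(_, X)]s0; apply: bin_dominate; rewrite -s0 -mulnA mulnn.
  by move: Mm s0; clear; lia.
apply: (@leq_trans ('C(n - 1, n - k + 1 - 1) * 'C(m - n, s))).
  apply: (@leq_trans (#|popular m n k F|.+1 * 'C(m - n, s))).
    by rewrite -/s [_.+1 * 'C(_, _)]mulSnr mulnA ltn_add2l.
  by rewrite leq_mul2r ltn_neqAle popN popF orbT.
(* The last summand of [h], at [i = s], already suffices, since [r - 1 = k - s - 1]. *)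
rewrite /h -/s big_nat_recr /=; last by rewrite /s; move: kn nk; clear; lia.
have -> : n - k + 1 - 1 = k - s - 1 by rewrite /s; move: kn nk; clear; lia.
by rewrite addnA leq_addl.
Qed.

Theorem theorem14 (n k : nat) :
  k <= n -> n < 2 * k - 3 ->
  exists M : nat, forall m : nat, M <= m ->
    alpha m n k = h m n k /\
    (forall F : {set {set 'I_m}},
       mnk_family m n k F -> #|F| = alpha m n k ->
       exists t : 'I_m, t < n /\ F = Hfam m n k t).
Proof.
move=> kn nk.
exists (n + 2 * (2 * k - n - 1) + 2 ^ n * (2 * k - n - 1) ^ 2) => m Mm.
have nm : n <= m by move: Mm; clear; lia.
have alphaE : alpha m n k = h m n k.
  apply/eqP; rewrite eqn_leq; apply/andP; split.
    apply/bigmax_leqP => F /mnk_familyP mnkF.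
    have [/ltnW//|hF] := ltnP #|F| (h m n k).
    have [t tL Ft] := mnk_family_star m n k F kn nk Mm mnkF hF.
    by rewrite -(card_Hfam m n k kn nk nm t tL) subset_leq_card.
  have m0 : 0 < m by move: kn nk nm; clear; lia.
  (* For the lower bound any [t] in [[n]] will do; the first point is taken. *)
  have tL : Ordinal m0 \in lowset m n by rewrite inE /=; move: kn nk; clear; lia.
  rewrite -(card_Hfam m n k kn nk nm _ tL).
  apply: (@leq_bigmax_cond _ (mnk_familyb m n k) (fun F : {set {set 'I_m}} => #|F|)).
  by apply/mnk_familyP/Hfam_mnk.
split=> // F mnkF; rewrite alphaE => cF.
have [t tL Ft] : exists2 t : 'I_m, t \in lowset m n & F \subset Hfam m n k t.
  by apply: mnk_family_star; rewrite ?cF.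
exists t; split; first by rewrite inE in tL.
by apply/eqP; rewrite eqEcard Ft card_Hfam // cF leqnn.
Qed.
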